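(* Let $T$ be a commutative ring and $I\subset T$ be an ideal. Then a $T$-module $M$ is quite $I$-torsion if and only if, for every element $m\in M$ and every sequence of elements $s_0,s_1,s_2,\dots\in I$ (indexed by the nonnegative integers), there exists an integer $n\ge0$ such that $s_ns_{n-1}\cdots s_1s_0m=0$ in $M$. It suffices to check the latter condition for sequences of elements $s_i$, $i\ge0$, belonging to any given set of generators $G\subset I$ of the ideal $I\subset T$.
   Context: For a $T$-module $M$, define submodules $F^{(I)}_\alpha M\subset M$ by transfinite induction: $F^{(I)}_0M=\{m\in M\mid Im=0\}$ and $F^{(I)}_\alpha M=\{m\in M\mid Im\subset\bigcup_{\beta<\alpha}F^{(I)}_\beta M\}$ for all ordinals $\alpha>0$. The $T$-module $M$ is called quite $I$-torsion if $M=\bigcup_\beta F^{(I)}_\beta M$, the union being taken over all ordinals $\beta$. *)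

(* Defs.v *)
From mathcomp Require Import all_boot all_order all_algebra.
From mathcomp Require Import boolp wochoice classical_sets.

Set Implicit Arguments.
Unset Strict Implicit.
Unset Printing Implicit Defensive.

Import GRing.Theory.

(* Ordinals are represented by well-ordered types; distinct representatives of
   the same ordinal are not identified. *)
Record wordinal := Wordinal {
  wo_sort :> eqType;
  wo_le : rel wo_sort;
  wo_leP : well_order wo_le }.

Arguments wo_le {w} : rename.

Definition wo_lt (a : wordinal) : rel a := fun x y => (x != y) && wo_le x y.

Arguments wo_lt {a}.

(* [b] is isomorphic to the proper initial segment of [a] below some [z : a]. *)
Definition ord_lt (b a : wordinal) : Prop :=
  exists (z : a) (f : b -> a),
    {mono f : x y / wo_le x y} /\
    (forall y : a, wo_lt y z <-> exists x : b, f x = y).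

Definition ord_zero (a : wordinal) : Prop := a -> False.

Lemma wo_total (a : wordinal) : total (@wo_le a).
Proof.
have C : wo_chain (@wo_le a) predT by apply: withinW; apply: wo_leP.
by move=> x y; apply: (wo_chainW C).
Qed.

Lemma wo_refl (a : wordinal) : reflexive (@wo_le a).
Proof. by move=> x; have := wo_total x x; rewrite orbb. Qed.

Lemma wo_anti (a : wordinal) : antisymmetric (@wo_le a).
Proof.
have C : wo_chain (@wo_le a) predT by apply: withinW; apply: wo_leP.
by move=> x y; apply: (wo_chain_antisymmetric C).
Qed.

Lemma wo_trans (a : wordinal) : transitive (@wo_le a).
Proof.
move=> y x z xy yz.
have [|m [[]]] := @wo_leP a [pred t | t \in [:: x; y; z]].
  by exists x; rewrite !inE eqxx.
rewrite !inE => /or3P[] /eqP-> lb _; first by apply: lb; rewrite !inE eqxx !orbT.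
- have yx : wo_le y x by apply: lb; rewrite !inE eqxx.
  by have -> : x = y by apply: wo_anti; rewrite xy.
- have zy : wo_le z y by apply: lb; rewrite !inE eqxx orbT.
  by have <- : y = z by apply: wo_anti; rewrite yz.
Qed.

Lemma wo_lt_wf (a : wordinal) : well_founded (@wo_lt a).
Proof.
move=> x; apply: contrapT => nAx.
have [|m [[mA lb] _]] := @wo_leP a (fun t => `[< ~ Acc (@wo_lt a) t >]).
  by exists x; apply/asboolP.
have nAm : ~ Acc (@wo_lt a) m by apply/asboolP.
apply: nAm; constructor=> y /andP[ny ym].
apply: contrapT => nAy; have my : wo_le m y by apply: lb; apply/asboolP.
by case/eqP: ny; apply: wo_anti; rewrite ym.
Qed.

Lemma wo_lt_mono (a b : wordinal) (f : b -> a) :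
  {mono f : x y / wo_le x y} -> {mono f : x y / wo_lt x y}.
Proof.
move=> fm x y; rewrite /wo_lt fm; congr (~~ _ && _); apply/eqP/eqP => [e|->//].
by apply: (@wo_anti b); rewrite -(fm x) -(fm y) e wo_refl.
Qed.

Lemma wo_lt_trans (a : wordinal) : transitive (@wo_lt a).
Proof.
move=> y x z /andP[nxy xy] /andP[nyz yz]; rewrite /wo_lt (wo_trans xy yz) andbT.
by apply: contraNneq nxy => xz; apply/eqP/wo_anti; rewrite xy xz yz.
Qed.

Lemma ord_lt_wf : well_founded ord_lt.
Proof.
have seg (a : wordinal) (z : a) (b : wordinal) (f : b -> a) :
    {mono f : x y / wo_le x y} ->
    (forall y, wo_lt y z <-> exists x, f x = y) -> Acc ord_lt b.
  elim: z / (wo_lt_wf z) b f => z _ IH b f fm fz.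
  constructor=> c [w [g [gm gw]]].
  apply: (IH (f w) _ c (f \o g)).
  - by apply/fz; exists w.
  - by move=> x y /=; rewrite fm gm.
  - move=> y; split=> [yw|[x <-]].
      have /fz[v ev] : wo_lt y z by apply: (wo_lt_trans yw); apply/fz; exists w.
      move: yw; rewrite -ev (wo_lt_mono fm) => /gw[x <-]; by exists x.
    by rewrite /= (wo_lt_mono fm); apply/gw; exists x.
by move=> a; constructor=> b [z [f [fm fz]]]; apply: (seg a z b f).
Qed.

Definition ord_le (b a : wordinal) : Prop :=
  exists2 f : b -> a, {mono f : x y / wo_le x y} &
    forall (y : a) (x : b), wo_lt y (f x) -> exists x', f x' = y.

Lemma ord_lt_le_trans (c b a : wordinal) :
  ord_lt c b -> ord_le b a -> ord_lt c a.
Proof.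
move=> [z [g [gm gz]]] [f fm fs]; exists (f z), (f \o g); split.
  by move=> x y /=; rewrite fm gm.
move=> y; split=> [/[dup] /fs[x <-]|[x <-]] /=; rewrite (wo_lt_mono fm).
  by move/gz => [w <-]; exists w.
by apply/gz; exists x.
Qed.

Lemma ord_lt_ex (a : wordinal) : ~ ord_zero a -> exists b, ord_lt b a.
Proof.
move=> a0; have [z _] : exists z : a, True.
  by apply: contrapT => nz; apply: a0 => z; apply: nz; exists z.
have wo : @well_order {x : a | wo_lt x z} (fun x y => wo_le (sval x) (sval y)).
  apply: antisymmetric_well_order => [x y /wo_anti /val_inj //|A [x Ax]].
  have [|m [[mA lb] _]] := @wo_leP a
      (fun t => `[< exists2 y : {x : a | wo_lt x z}, y \in A & sval y = t >]).
    by exists (sval x); apply/asboolP; exists x.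
  have [y Ay ym] : exists2 y : {x : a | wo_lt x z}, y \in A & sval y = m.
    by apply/asboolP.
  exists y; split=> // w Aw; rewrite ym.
  by apply: lb; apply/asboolP; exists w.
exists (Wordinal wo), z, sval; split=> // y.
by split=> [yz|[[x xz] <-//]]; exists (exist _ y yz).
Qed.

Lemma ord_lt_total (a b c : wordinal) :
  ord_lt b a -> ord_lt c a -> ord_le b c \/ ord_le c b.
Proof.
have le (p q : wordinal) (u v : a) (f : p -> a) (g : q -> a) :
    {mono f : x y / wo_le x y} -> (forall y, wo_lt y u <-> exists x, f x = y) ->
    {mono g : x y / wo_le x y} -> (forall y, wo_lt y v <-> exists x, g x = y) ->
    wo_le u v -> ord_le p q.
  move=> fm fu gm gv uv.
  have fv x : exists y, g y = f x.
    apply/gv; have /andP[n xu] : wo_lt (f x) u by apply/fu; exists x.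
    rewrite /wo_lt (wo_trans xu uv) andbT; apply: contraNneq n => e.
    by apply/eqP/wo_anti; rewrite xu e uv.
  have [h hE] := choice fv; exists h => [x y|y x].
    by rewrite -gm !hE fm.
  rewrite -(wo_lt_mono gm) hE => yx.
  have /fu[x' ex'] : wo_lt (g y) u.
    by apply: (wo_lt_trans yx); apply/fu; exists x.
  exists x'; apply: (@wo_anti q); have e : g (h x') = g y by rewrite hE.
  by rewrite -(gm (h x')) -(gm y) e wo_refl.
move=> [u [f [fm fu]]] [v [g [gm gv]]].
by case/orP: (wo_total u v) => uv; [left|right]; apply: le uv; eauto.
Qed.

Local Open Scope classical_set_scope.
Local Open Scope ring_scope.

Definition submodule (R : pzRingType) (V : lmodType R) (N : set V) : Prop :=
  GRing.submod_closed (mem N).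

Definition ideal (R : comPzRingType) (I : set R) : Prop :=
  submodule (I : set R^o).

Definition Itors_step (T : comPzRingType) (I : set T) (M : lmodType T)
    (a : wordinal) (F : forall b, ord_lt b a -> set M) : set M :=
  [set m : M |
    (ord_zero a /\ forall s, I s -> s *: m = 0) \/
    (~ ord_zero a /\
     forall s, I s -> exists (b : wordinal) (ba : ord_lt b a), F b ba (s *: m))].

Definition Itors_filt (T : comPzRingType) (I : set T) (M : lmodType T) :
    wordinal -> set M :=
  Fix ord_lt_wf (fun=> set M) (@Itors_step T I M).

Arguments Itors_filt {T} I M a _.

Definition quite_torsion (T : comPzRingType) (I : set T) (M : lmodType T) : Prop :=
  forall m : M, exists a : wordinal, Itors_filt I M a m.

Section Filtration.
Variables (T : comPzRingType) (I : set T) (M : lmodType T).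
Local Notation F := (Itors_filt I M).

Lemma Itors_filtE (a : wordinal) :
  F a = Itors_step I (fun b (_ : ord_lt b a) => F b).
Proof.
rewrite /Itors_filt Fix_eq // => c G H GH; rewrite /Itors_step; apply/predeqP => m.
by split=> -[?|[nz h]]; [left|right|left|right] => //; split=> // s /h[b [bc]];
  [rewrite GH|rewrite -GH]; exists b, bc.
Qed.

Lemma Itors_filt_zero (a : wordinal) : ord_zero a ->
  F a = [set m | forall s, I s -> s *: m = 0].
Proof.
move=> a0; rewrite Itors_filtE; apply/predeqP => m; split=> [[[]|[]]//|h].
by left.
Qed.

Lemma Itors_filt_pos (a : wordinal) : ~ ord_zero a ->
  F a = [set m | forall s, I s -> exists2 b, ord_lt b a & F b (s *: m)].
Proof.
move=> a0; rewrite Itors_filtE; apply/predeqP => m; split=> [[[]|[_ h]]//|h].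
  by move=> s /h[b [ba]]; exists b.
by right; split=> // s /h[b ba]; exists b, ba.
Qed.

Lemma Itors_filt0 (a : wordinal) : F a 0.
Proof.
elim/(well_founded_ind ord_lt_wf): a => a IH.
have [a0|a0] := pselect (ord_zero a).
  by rewrite Itors_filt_zero // => t _; rewrite scaler0.
rewrite Itors_filt_pos // => t _; rewrite scaler0.
by have [b ba] := ord_lt_ex a0; exists b => //; apply: IH.
Qed.

Lemma Itors_filt_le (b a : wordinal) : ord_le b a -> F b `<=` F a.
Proof.
move=> ba m.
have [a0|a0] := pselect (ord_zero a).
  have b0 : ord_zero b by case: ba => f _ _ /f.
  by rewrite !Itors_filt_zero.
have [b0|b0] := pselect (ord_zero b).
  rewrite Itors_filt_zero // Itors_filt_pos // => h s Is; rewrite h //.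
  by have [c ca] := ord_lt_ex a0; exists c => //; apply: Itors_filt0.
rewrite !Itors_filt_pos // => h s /h[c cb Fc].
by exists c => //; apply: ord_lt_le_trans ba.
Qed.

Lemma Itors_filt_submodule (a : wordinal) : submodule (F a).
Proof.
elim/(well_founded_ind ord_lt_wf): a => a IH.
split=> [|c u v]; rewrite ?inE; first exact: Itors_filt0.
have E s : s *: (c *: u + v) = c *: (s *: u) + s *: v.
  by rewrite scalerDr !scalerA mulrC.
have [a0|a0] := pselect (ord_zero a).
  rewrite Itors_filt_zero // => Fu Fv s Is.
  by rewrite E Fu // Fv // scaler0 addr0.
rewrite Itors_filt_pos // => Fu Fv s Is.
have [b ba Fb] := Fu _ Is; have [d da Fd] := Fv _ Is; rewrite E.
have [bd|db] := ord_lt_total ba da.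
  exists d => //; have [_ L] := IH _ da.
  by apply/set_mem/L; apply/mem_set => //; apply: Itors_filt_le Fb.
exists b => //; have [_ L] := IH _ ba.
by apply/set_mem/L; apply/mem_set => //; apply: Itors_filt_le Fd.
Qed.

End Filtration.

(* Main.v *)
(* If [m] lies in the filtration, multiplying by an element of [I] strictly
   lowers the ordinal, so every sequence of multipliers kills [m].  Conversely,
   the union [U] of the filtration is a submodule, and [I m] contained in [U]
   forces [m] in [U], as the set of ordinals witnessing [s m] in [U] for [s] in
   [I] is bounded.  Since the transporter of [m] into [U] is an ideal, a
   generating set [G] may replace [I] here.  So from [m] outside of [U] one
   builds by dependent choice a sequence in [G] all of whose partial products
   keep [m] outside of [U], hence nonzero. *)

Require Import Defs.
From mathcomp Require Import all_boot all_order all_algebra.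
From mathcomp Require Import boolp wochoice classical_sets.

Set Implicit Arguments.
Unset Strict Implicit.
Unset Printing Implicit Defensive.

Import GRing.Theory.
Local Open Scope classical_set_scope.
Local Open Scope ring_scope.

Lemma ord_lt_segment (a : wordinal) (z : a) :
  exists (b : wordinal) (f : b -> a), {mono f : x y / wo_le x y} /\
    forall y : a, wo_lt y z <-> exists x : b, f x = y.
Proof.
have wo : @well_order {x : a | wo_lt x z} (fun x y => wo_le (sval x) (sval y)).
  apply: antisymmetric_well_order => [x y /wo_anti /val_inj //|A [x Ax]].
  have [|m [[mA lb] _]] := @wo_leP a
      (fun t => `[< exists2 y : {x : a | wo_lt x z}, y \in A & sval y = t >]).
    by exists (sval x); apply/asboolP; exists x.
  have /asboolP[y Ay ym] := mA.
  exists y; split=> // w Aw; rewrite ym.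
  by apply: lb; apply/asboolP; exists w.
exists (Wordinal wo), sval; split=> // y.
by split=> [yz|[[x xz] <-//]]; exists (exist _ y yz).
Qed.

Local Notation osum_in b x := (Tagged (fun j => wo_sort (b j)) x).

Section OrdinalSum.
Variables (J : wordinal) (b : J -> wordinal).

(** Lexicographic order on the disjoint union, with [None] added as a top element to serve as a
    strict upper bound. *)
Definition osum_le : rel (option {j : J & b j}) := fun u v =>
  match u, v with
  | _, None => true
  | None, Some _ => false
  | Some x, Some y => wo_lt (tag x) (tag y) ||
      (tag x == tag y) && wo_le (tagged x) (tagged_as x y)
  end.

(** A least element is found in two stages: the least index met by [A], then the least element of
    [A] in that summand. [None] is least only when [A] has no other element. *)
Lemma osum_well_order : well_order osum_le.
Proof.
apply: antisymmetric_well_order => [[[i x]|] [[j y]|]|A [u Au]] //=.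
  have [e|ne] := eqVneq i j.
    case: j / e y => y; rewrite /wo_lt eqxx /= !tagged_asE => h.
    by rewrite (wo_anti h).
  by rewrite /wo_lt ne eq_sym ne /= !orbF => /wo_anti e; rewrite e eqxx in ne.
have [[[i x] Ax]|nA] := pselect (exists v, Some v \in A); last first.
  by exists None; split=> [|[v|] Av] //; [case: u Au => // v Av|];
    case: nA; exists v.
have [|i0 [[/asboolP[x0 Ax0] ilb] _]] :=
    @wo_leP J (fun i => `[< exists x : b i, Some (osum_in b x) \in A >]).
  by exists i; apply/asboolP; exists x.
have [|m [[Am mlb] _]] :=
    @wo_leP (b i0) (fun x => Some (osum_in b x) \in A).
  by exists x0.
exists (Some (osum_in b m)); split=> // -[[j y]|] // Ay /=.
have [e|ne] := eqVneq i0 j.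
  by case: j / e y Ay => y Ay; rewrite tagged_asE mlb ?orbT.
by rewrite orbF /wo_lt ne ilb //; apply/asboolP; exists y.
Qed.

Definition osum : wordinal := Wordinal osum_well_order.

End OrdinalSum.

(* The upper bound is the ordinal sum of the family plus a top element; the
   summands are not initial segments of it, only increasing images. *)
Lemma ord_family_bound (J : eqType) (b : J -> wordinal) :
  exists (a : wordinal) (z : a), forall j, exists2 f : b j -> a,
    {homo f : x y / wo_lt x y} & forall x, wo_lt (f x) z.
Proof.
have [le wo] := well_ordering_principle J.
exists (@osum (Wordinal wo) b), None => j.
exists (fun x => Some (osum_in b x)) => // x y /andP[nxy xy].
rewrite /wo_lt /= eqxx tagged_asE xy orbT andbT.
apply: contra nxy => /eqP[] e; apply/eqP.
by have := congr1 (tagged_as (osum_in b x)) e;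
  rewrite !tagged_asE.
Qed.

Section Torsion.
Variables (T : comPzRingType) (I : set T) (M : lmodType T).
Local Notation F := (Itors_filt I M).

(** A strictly increasing [f] sends the segment of [b] below [z] into the segment of [a] below
    [f z], so induction applies even if the image of [f] is not an initial segment. *)
Lemma Itors_filt_homo (b a : wordinal) (f : b -> a) :
  {homo f : x y / wo_lt x y} -> F b `<=` F a.
Proof.
elim/(well_founded_ind ord_lt_wf): b a f => b IH a f fh m.
have [b0|b0] := pselect (ord_zero b).
  rewrite Itors_filt_zero // => h; have [a0|a0] := pselect (ord_zero a).
    by rewrite Itors_filt_zero.
  rewrite Itors_filt_pos // => s Is; rewrite h //.
  by have [c ca] := ord_lt_ex a0; exists c => //; apply: Itors_filt0.
have a0 : ~ ord_zero a by move=> a0; apply: b0 => x; apply: a0 (f x).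
rewrite !Itors_filt_pos // => h s /h[c cb Fc].
have [z [g [gm gz]]] := cb; have [d [k [km kz]]] := ord_lt_segment (f z).
exists d; first by exists (f z), k.
have fgk x : exists y, k y = f (g x) by apply/kz/fh/gz; exists x.
have [h' h'E] := choice fgk; apply: (IH c cb d h') Fc => x y xy.
by rewrite -(wo_lt_mono km) !h'E; apply: fh; rewrite (wo_lt_mono gm).
Qed.

Definition Itors_union : set M := [set m | exists a, F a m].

(** Every [b j] maps increasingly into the segment below the common bound [z], so this one segment
    serves as [c] for all [j]. *)
Lemma Itors_filt_family (J : eqType) (b : J -> wordinal) :
  exists2 a, ~ ord_zero a &
    forall j, exists2 c, ord_lt c a & F (b j) `<=` F c.
Proof.
have [a [z az]] := ord_family_bound b; exists a; first by move/(_ z).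
have [c [k [km kz]]] := ord_lt_segment z.
move=> j; exists c; first by exists z, k.
have [f fh fz] := az j.
have [g gE] := choice (fun x => (kz (f x)).1 (fz x)).
apply: (@Itors_filt_homo _ _ g) => x y xy.
by rewrite -(wo_lt_mono km) !gE; apply: fh.
Qed.

Lemma ord_lt_Itors_filt (b a : wordinal) : ord_lt b a -> F b `<=` F a.
Proof.
move=> [z [f [fm _]]]; apply: (@Itors_filt_homo _ _ f) => x y.
by rewrite (wo_lt_mono fm).
Qed.

Lemma Itors_union_submodule : submodule Itors_union.
Proof.
split=> [|c u v]; rewrite ?inE.
  have [le wo] := well_ordering_principle unit.
  by exists (Wordinal wo); apply: Itors_filt0.
move=> [a Fu] [b Fv].
(* A common bound for [a] and [b] comes from the two-element family. *)
have [d _ dP] := @Itors_filt_family bool (fun i => if i then a else b).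
have [p pd ap] := dP true; have [q qd bq] := dP false.
exists d; have [_ L] := Itors_filt_submodule I M d.
apply/set_mem/L; apply/mem_set; first exact/(ord_lt_Itors_filt pd)/ap.
exact/(ord_lt_Itors_filt qd)/bq.
Qed.

Lemma Itors_union_closed (m : M) :
  (forall s, I s -> Itors_union (s *: m)) -> Itors_union m.
Proof.
move=> h; have [le wo] := well_ordering_principle unit.
have /choice[b bP] : forall s, exists b, I s -> F b (s *: m).
  (* The family is indexed by all of [T]; outside [I] any ordinal will do. *)
  move=> s; have [Is|nIs] := pselect (I s); last by exists (Wordinal wo).
  by have [b Fb] := h s Is; exists b.
have [a a0 aP] := Itors_filt_family b; exists a.
rewrite Itors_filt_pos // => s Is; have [c ca bc] := aP s.
by exists c => //; apply/bc/bP.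
Qed.

Lemma Itors_union_closed_gen (G : set T) (m : M) :
  smallest (@ideal T) G = I ->
  (forall s, G s -> Itors_union (s *: m)) -> Itors_union m.
Proof.
move=> GI h; apply: Itors_union_closed => s; rewrite -GI => Is.
have [U0 UL] := Itors_union_submodule.
(* The smallest ideal is an intersection, hence lies in the transporter of [m] into the union. *)
apply: (Is [set t | Itors_union (t *: m)]); split=> //.
split=> [|c u v]; rewrite ?inE /=.
  by rewrite scale0r; apply/set_mem.
by move=> Uu Uv; rewrite scalerDl -scalerA; apply/set_mem/UL; apply/mem_set.
Qed.

Lemma Itors_filt_vanish (a : wordinal) (m : M) (s : nat -> T) :
  F a m -> (forall i, I (s i)) ->
  exists n : nat, (\prod_(i < n.+1) s i) *: m = 0.
Proof.
elim/(well_founded_ind ord_lt_wf): a m s => a IH m s.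
have [a0|a0] := pselect (ord_zero a).
  by rewrite Itors_filt_zero // => Fm Is; exists 0; rewrite big_ord1 Fm.
rewrite Itors_filt_pos // => Fm Is; have [b ba Fb] := Fm _ (Is 0).
(* The shifted sequence kills [s 0 *: m], which sits at the lower ordinal [b]. *)
have [n n0] := IH b ba _ (s \o succn) Fb (fun i => Is i.+1).
by exists n.+1; rewrite big_ord_recl mulrC -scalerA.
Qed.

Lemma quite_torsion_gen (G : set T) : smallest (@ideal T) G = I ->
  (forall (m : M) (s : nat -> T), (forall i, G (s i)) ->
     exists n : nat, (\prod_(i < n.+1) s i) *: m = 0) ->
  quite_torsion I M.
Proof.
move=> GI h m; suff : Itors_union m by [].
apply: contrapT => nUm.
have /choice[g gP] : forall x, exists s,
    ~ Itors_union x -> G s /\ ~ Itors_union (s *: x).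
  move=> x; apply: contrapT => nx.
  (* For [x] in the union the implication is vacuous, and [0] is a dummy value. *)
  have nUx : ~ Itors_union x by move=> Ux; apply: nx; exists 0.
  apply: nUx; apply: (Itors_union_closed_gen GI) => s Gs.
  by apply: contrapT => nUs; apply: nx; exists s.
pose x n := iter n (fun y => g y *: y) m.
have nUx n : ~ Itors_union (x n) by elim: n => //= n /gP[].
have [n n0] := h m (g \o x) (fun i => (gP _ (nUx i)).1).
have xE k : (\prod_(i < k) (g \o x) i) *: m = x k.
  elim: k => [|k IHk]; first by rewrite big_ord0 scale1r.
  by rewrite big_ord_recr /= mulrC -scalerA IHk.
apply: (nUx n.+1); rewrite -xE n0.
by have [/set_mem] := Itors_union_submodule.
Qed.

End Torsion.

Theorem proposition1p9 (T : comPzRingType) (I : set T) (hI : ideal I)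
    (M : lmodType T) :
  (quite_torsion I M <->
   forall (m : M) (s : nat -> T), (forall i, I (s i)) ->
     exists n : nat, (\prod_(i < n.+1) s i) *: m = 0)
  /\
  (forall G : set T, G `<=` I -> smallest (@ideal T) G = I ->
   (forall (m : M) (s : nat -> T), (forall i, G (s i)) ->
      exists n : nat, (\prod_(i < n.+1) s i) *: m = 0) ->
   quite_torsion I M).
Proof.
split=> [|G _]; last exact: quite_torsion_gen.
(* The converse is the case [G = I]: an ideal is the smallest ideal containing itself. *)
split=> [qt m s|]; last exact/quite_torsion_gen/smallest_id.
by have [a] := qt m; apply: Itors_filt_vanish.
Qed.
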